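(* Let $\mathfrak R$ be a topologically semiperfect topological ring, $\mathfrak H=\mathfrak H(\mathfrak R)$ be its topological Jacobson radical, and $\mathfrak S=\mathfrak R/\mathfrak H$ be the related topological quotient ring. Then any finite orthogonal family of primitive idempotents in $\mathfrak S$ can be lifted modulo $\mathfrak H$ to a finite orthogonal family of local idempotents in $\mathfrak R$.
   Context: All rings are associative and unital. All topological rings are complete, separated and right linear: open right ideals $\mathfrak I$ form a base of neighborhoods of zero and $\mathfrak R\to\varprojlim_{\mathfrak I}\mathfrak R/\mathfrak I$ is bijective. A family $(r_x)_{x\in X}$ in $\mathfrak R$ is zero-convergent if every open right ideal contains $r_x$ for all but finitely many $x$; infinite sums of zero-convergent families are limits of finite partial sums. A nonzero ring is local if its noninvertible elements form an additive subgroup. $\mathfrak R$ is topologically semiperfect if there exist a set $Z$ and a zero-convergent family $(e_z)_{z\in Z}$ of pairwise orthogonal idempotents in $\mathfrak R$ with $\sum_{z\in Z}e_z=1$ such that every ring $e_z\mathfrak R e_z$ is local. The topological Jacobson radical $\mathfrak H(\mathfrak R)$ is the intersection of all open maximal right ideals of $\mathfrak R$; it is a closed two-sided ideal. The ring $\mathfrak R/\mathfrak H$ carries the quotient topology. An idempotent $e$ in a ring $R$ is local if the ring $eRe$ is local; a nonzero idempotent is primitive if it is not a sum of two nonzero orthogonal idempotents. *)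

(* Defs.v *)
From HB Require Import structures.
From mathcomp Require Import all_boot all_algebra.
From mathcomp Require Import generic_quotient ring_quotient.
From mathcomp Require Import all_classical topology normedtype.
From mathcomp.analysis.showcase Require Import summability.

Set Implicit Arguments.
Unset Strict Implicit.
Unset Printing Implicit Defensive.

Import GRing.Theory.

Local Open Scope classical_set_scope.
Local Open Scope ring_scope.
Local Open Scope quotient_scope.

(* Rings are [pzRingType]s: associative, unital, not assumed commutative and
   possibly zero. *)

Definition additive_subgroup (V : zmodType) (A : set V) : Prop :=
  A 0 /\ forall x y, A x -> A y -> A (x - y).

Section Rings.
Variable R : pzRingType.
Implicit Types (e x y : R) (I M : set R).

Definition right_ideal I : Prop :=
  additive_subgroup I /\ forall x r, I x -> I (x * r).

Definition maximal_right_ideal M : Prop :=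
  [/\ right_ideal M, M != setT &
      forall J, right_ideal J -> M `<=` J -> J = M \/ J = setT].

Definition invertible x : Prop := exists y, x * y = 1 /\ y * x = 1.

Definition local_ring : Prop :=
  1 != 0 :> R /\ additive_subgroup [set x | ~ invertible x].

Definition idempotent_elt e : Prop := e * e = e.

Definition orthogonal_family (Z : Type) (e : Z -> R) : Prop :=
  forall z w, z <> w -> e z * e w = 0.

Definition primitive_idempotent e : Prop :=
  [/\ idempotent_elt e, e != 0 &
      ~ exists a b, [/\ idempotent_elt a, idempotent_elt b, a != 0, b != 0 &
                        [/\ a * b = 0, b * a = 0 & e = a + b]]].

Definition corner_pred e : pred R := fun x => e * x * e == x.

Lemma corner_zmod_closed e : zmod_closed (corner_pred e).
Proof.
split=> [|x y]; rewrite !unfold_in ?mulr0 ?mul0r //.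
by move=> /eqP hx /eqP hy; rewrite mulrBr mulrBl hx hy.
Qed.

HB.instance Definition _ e :=
  GRing.isZmodClosed.Build R (corner_pred e) (corner_zmod_closed e).

End Rings.

(* The ring e R e, with unit element e; it is the set of x with e x e = x
   because e is idempotent. *)
Definition corner (R : pzRingType) (e : R) of idempotent_elt e : Type :=
  {x : R | corner_pred e x}.

Section Corner.
Variables (R : pzRingType) (e : R) (he : idempotent_elt e).
Local Notation C := (corner he).

HB.instance Definition _ := SubChoice.on C.
HB.instance Definition _ := [SubChoice_isSubZmodule of C by <:].

Lemma corner_one_subproof : corner_pred e e.
Proof. by rewrite /corner_pred !he. Qed.

Lemma corner_mul_subproof (x y : C) : corner_pred e (val x * val y).
Proof.
have /eqP hx := valP x; have /eqP hy := valP y.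
rewrite /corner_pred; apply/eqP; rewrite -{1}hx -{1}hy !mulrA he.
by rewrite -(mulrA _ e e) he -[X in _ = X * _]hx -[X in _ = _ * X]hy !mulrA.
Qed.

Definition corner_one : C := Sub e corner_one_subproof.
Definition corner_mul (x y : C) : C :=
  Sub (val x * val y) (corner_mul_subproof x y).

Lemma corner_mulrA : associative corner_mul.
Proof. by move=> x y z; apply: val_inj; rewrite !SubK mulrA. Qed.

Lemma corner_mul1r : left_id corner_one corner_mul.
Proof.
move=> x; apply: val_inj; rewrite !SubK; have /eqP hx := valP x.
by rewrite -hx !mulrA he.
Qed.

Lemma corner_mulr1 : right_id corner_one corner_mul.
Proof.
move=> x; apply: val_inj; rewrite !SubK; have /eqP hx := valP x.
by rewrite -hx -!mulrA he.
Qed.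

Lemma corner_mulrDl : left_distributive corner_mul +%R.
Proof. by move=> x y z; apply: val_inj; rewrite !SubK mulrDl. Qed.

Lemma corner_mulrDr : right_distributive corner_mul +%R.
Proof. by move=> x y z; apply: val_inj; rewrite !SubK mulrDr. Qed.

HB.instance Definition _ := GRing.Zmodule_isPzRing.Build C
  corner_mulrA corner_mul1r corner_mulr1 corner_mulrDl corner_mulrDr.

End Corner.

Definition local_idempotent (R : pzRingType) (e : R) : Prop :=
  exists he : idempotent_elt e, local_ring (corner he).

HB.mixin Record TopologicalZmodule_isTopologicalPzRing R
    & TopologicalZmodule R & GRing.PzRing R := {
  mul_continuous : continuous (fun x : R * R => x.1 * x.2)
}.

#[short(type="topPzRingType")]
HB.structure Definition TopologicalPzRing :=
  {R of TopologicalZmodule R & GRing.PzRing R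
      & TopologicalZmodule_isTopologicalPzRing R}.

Section TopologicalRings.
Variable R : topPzRingType.
Implicit Types (I J M : set R).

Definition open_right_ideal I : Prop := open I /\ right_ideal I.

Definition right_linear : Prop :=
  forall U, nbhs (0 : R) U -> exists2 I, open_right_ideal I & I `<=` U.

Definition add_coset I (r : R) : set R := [set x | I (x - r)].

(* A point of the inverse limit of the groups R/I, over the open right ideals
   I: a choice of a coset of each such I, compatible with the projections
   R/I -> R/J for I included in J. The values of [c] at other sets are
   irrelevant. *)
Definition inverse_limit_point (c : set R -> set R) : Prop :=
  (forall I, open_right_ideal I -> exists r, c I = add_coset I r) /\
  (forall I J, open_right_ideal I -> open_right_ideal J -> I `<=` J ->
     c I `<=` c J).

(* Bijectivity of R -> lim R/I. *)
Definition complete_separated : Prop :=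
  forall c, inverse_limit_point c ->
    exists! r, forall I, open_right_ideal I -> c I = add_coset I r.

Definition zero_convergent (Z : Type) (r : Z -> R) : Prop :=
  forall I, open_right_ideal I -> finite_set [set z | ~ I (r z)].

Definition topologically_semiperfect : Prop :=
  exists (Z : choiceType) (e : Z -> R),
    [/\ zero_convergent e, orthogonal_family e,
        partial_sum e @ totally --> (1 : R) &
        forall z, local_idempotent (e z)].

Definition top_jacobson : set R :=
  \bigcap_(M in [set M | open M /\ maximal_right_ideal M]) M.

Lemma top_jacobson_subgroup : additive_subgroup top_jacobson.
Proof.
split=> [M [_ [[[]]]] //|x y hx hy M hM].
by have [_ [[[_ +] _] _ _]] := hM; apply; [exact: hx|exact: hy].
Qed.

Lemma top_jacobsonMr (x r : R) : top_jacobson x -> top_jacobson (x * r).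
Proof.
by move=> hx M hM; have [_ [[_ +] _ _]] := hM; apply; exact: hx.
Qed.

Lemma mulr_continuous (s : R) : continuous (fun x : R => s * x).
Proof.
move=> x; apply: (@continuous_comp _ _ _ (fun x => (s, x))
  (fun x : R * R => x.1 * x.2)); last exact: mul_continuous.
by apply: cvg_pair => /=; [exact: cvg_cst|exact: cvg_id].
Qed.

Lemma top_jacobsonMl (s x : R) : top_jacobson x -> top_jacobson (s * x).
Proof.
move=> hx M hM; have [oM [[[M0 MB] MM] MT maxM]] := hM.
have [Ms|nMs] := pselect (M s); first exact: MM.
apply: (hx [set y | M (s * y)]); split.
  by move: oM; apply: (continuousP _).1; exact: mulr_continuous.
split.
- split=> [|y r /= ?]; last by rewrite mulrA; apply: MM.
  by split=> [|y z /= ? ?]; rewrite /= ?mulr0 // mulrBr; apply: MB.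
- by apply/eqP => /seteqP[_ /(_ 1 I)] /=; rewrite mulr1.
move=> J [[J0 JB] JM] NJ.
have [JN|/existsNP[j /not_implyP[Jj nNj]]] :=
    pselect (forall j, J j -> M (s * j)).
  by left; apply/seteqP; split.
right; pose K := [set m + s * i | m in M & i in J].
have KK : right_ideal K.
  split=> [|_ r [m Mm [i Ji <-]]].
    split=> [|_ _ [m Mm [i Ji <-]] [n Mn [k Jk <-]]].
      by exists 0 => //; exists 0 => //; rewrite mulr0 addr0.
    exists (m - n); first exact: MB.
    by exists (i - k); [exact: JB|rewrite mulrBr opprD addrACA].
  exists (m * r); first exact: MM.
  by exists (i * r); [exact: JM|rewrite mulrDl mulrA].
have MK : M `<=` K.
  by move=> m Mm; exists m => //; exists 0 => //; rewrite mulr0 addr0.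
have [KM|KT] := maxM _ KK MK.
  case: nNj; rewrite /= -KM; exists 0 => //.
  by exists j => //; rewrite add0r.
have : K s by rewrite KT.
move=> [m Mm [i Ji /eqP]]; rewrite addrC -subr_eq0 => /eqP h.
have J1 : J 1.
  have N1 : J (1 - i).
    apply: NJ => /=; rewrite mulrBr mulr1.
    suff -> : s - s * i = m by [].
    by apply/eqP; rewrite subr_eq addrC eq_sym -subr_eq0 h.
  rewrite -[1](subrK i) -[X in _ + X]opprK; apply: (JB) => //.
  by rewrite -[- i]sub0r; apply: JB.
by apply/seteqP; split=> // y _; rewrite -[y]mul1r; apply: JM.
Qed.

Definition top_jacobson_pred : pred R := fun x => `[< top_jacobson x >].

Lemma top_jacobson_zmod_closed : zmod_closed top_jacobson_pred.
Proof.
have [h0 hB] := top_jacobson_subgroup.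
split=> [|x y]; first exact/asboolP.
by move=> /asboolP hx /asboolP hy; apply/asboolP; exact: hB.
Qed.

HB.instance Definition _ :=
  GRing.isZmodClosed.Build R top_jacobson_pred top_jacobson_zmod_closed.

(* MathComp provides the quotient group; its ring quotients are restricted to
   commutative rings, so the multiplication is added below. *)
Definition top_jacobson_closed : zmodClosed R :=
  GRing.ZmodClosed.clone _ top_jacobson_pred _.

Definition jacobson_quot : Type :=
  quotient_topology (Quotient.quot top_jacobson_closed).
Local Notation S := jacobson_quot.

HB.instance Definition _ := Quotient.on S.
HB.instance Definition _ := Topological.on S.
HB.instance Definition _ := GRing.isZmodule.Build S
  (@Quotient.addqA R top_jacobson_closed)
  (@Quotient.addqC R top_jacobson_closed)
  (@Quotient.add0q R top_jacobson_closed)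
  (@Quotient.addNq R top_jacobson_closed).

Lemma jacobson_quotP (x y : R) : \pi_S x = \pi_S y <-> top_jacobson (x - y).
Proof.
pose Q := Quotient.quot top_jacobson_closed.
have E : (x == y %[mod Q]) = top_jacobson_pred (x - y).
  by rewrite -Quotient.idealrBE.
split=> [h|/asboolP]; first by apply/asboolP; rewrite -[asbool _]E; apply/eqP.
by rewrite -[asbool _]E => /eqP.
Qed.

Lemma jacobson_piD (x y : R) : \pi_S (x + y) = \pi_S x + \pi_S y.
Proof. exact: (@Quotient.pi_add R top_jacobson_closed). Qed.

Lemma jacobson_piN (x : R) : \pi_S (- x) = - \pi_S x.
Proof. exact: (@Quotient.pi_opp R top_jacobson_closed). Qed.

Definition jacobson_quot_one : S := \pi_S 1.
Definition jacobson_quot_mul : S -> S -> S := lift_op2 S *%R.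

Lemma jacobson_quot_pi_mul (x y : R) :
  jacobson_quot_mul (\pi_S x) (\pi_S y) = \pi_S (x * y).
Proof.
unlock jacobson_quot_mul; apply/jacobson_quotP.
set x' := repr _; set y' := repr _.
have hx : top_jacobson (x' - x) by apply/jacobson_quotP; rewrite reprK.
have hy : top_jacobson (y' - y) by apply/jacobson_quotP; rewrite reprK.
have -> : x' * y' - x * y = (x' - x) * y' - - (x * (y' - y)).
  by rewrite opprK mulrBl mulrBr addrA subrK.
have [h0 hB] := top_jacobson_subgroup.
apply: (hB); first exact: top_jacobsonMr.
rewrite -[- (x * _)]sub0r; apply: hB; first exact: h0.
exact: top_jacobsonMl.
Qed.

Lemma jacobson_quot_mulrA : associative jacobson_quot_mul.
Proof.
move=> a b c; rewrite -[a]reprK -[b]reprK -[c]reprK.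
by rewrite !jacobson_quot_pi_mul mulrA.
Qed.

Lemma jacobson_quot_mul1r : left_id jacobson_quot_one jacobson_quot_mul.
Proof. by move=> a; rewrite -[a]reprK jacobson_quot_pi_mul mul1r. Qed.

Lemma jacobson_quot_mulr1 : right_id jacobson_quot_one jacobson_quot_mul.
Proof. by move=> a; rewrite -[a]reprK jacobson_quot_pi_mul mulr1. Qed.

Lemma jacobson_quot_mulrDl : left_distributive jacobson_quot_mul +%R.
Proof.
move=> a b c; rewrite -[a]reprK -[b]reprK -[c]reprK.
by rewrite -jacobson_piD !jacobson_quot_pi_mul -jacobson_piD mulrDl.
Qed.

Lemma jacobson_quot_mulrDr : right_distributive jacobson_quot_mul +%R.
Proof.
move=> a b c; rewrite -[a]reprK -[b]reprK -[c]reprK.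
by rewrite -jacobson_piD !jacobson_quot_pi_mul -jacobson_piD mulrDr.
Qed.

HB.instance Definition _ := GRing.Zmodule_isPzRing.Build S
  jacobson_quot_mulrA jacobson_quot_mul1r jacobson_quot_mulr1
  jacobson_quot_mulrDl jacobson_quot_mulrDr.

Lemma jacobson_pi1 : \pi_S 1 = 1.
Proof. by []. Qed.

Lemma jacobson_piM (x y : R) : \pi_S (x * y) = \pi_S x * \pi_S y.
Proof. by rewrite -jacobson_quot_pi_mul. Qed.

Lemma jacobson_pi_open (U : set R) : open U -> open (\pi_S @` U).
Proof.
move=> oU; rewrite /open/= /quotient_open.
have -> : \pi_(quotient_topology (Quotient.quot top_jacobson_closed))
            @^-1` (\pi_S @` U)
        = \bigcup_(h in top_jacobson) [set x | U (x + h)].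
  apply/seteqP; split=> [x [u Uu /jacobson_quotP ux]|x [h hh /= Uxh]].
    by exists (u - x) => //=; rewrite addrC subrK.
  by exists (x + h) => //; apply/jacobson_quotP; rewrite addrC addKr.
apply: bigcup_open => h _; move: oU; apply: (continuousP _).1 => x.
apply: (@continuous_comp _ _ _ (fun x => (x, h)) (fun x : R * R => x.1 + x.2)).
  by apply: cvg_pair => /=; [exact: cvg_id|exact: cvg_cst].
exact: add_continuous.
Qed.

Lemma jacobson_pi_nbhs (x : R) (U : set R) :
  nbhs x U -> nbhs (\pi_S x) (\pi_S @` U).
Proof.
rewrite !nbhsE => -[V [oV Vx] VU]; exists (\pi_S @` V).
  by split; [exact: jacobson_pi_open|exists x].
exact: image_subset.
Qed.

Lemma jacobson_quot_continuous2 (f : R * R -> R) (g : S * S -> S) :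
  (forall x y, g (\pi_S x, \pi_S y) = \pi_S (f (x, y))) ->
  continuous f -> continuous g.
Proof.
move=> fg cf [a b]; rewrite -[a]reprK -[b]reprK.
move: (repr a) (repr b) => x y W; rewrite fg => hW.
have [[A B] /= [hA hB] AB] : nbhs (x, y) (f @^-1` (\pi_S @^-1` W)).
  by apply: cf; exact: (@pi_continuous R (Quotient.quot top_jacobson_closed)).
exists (\pi_S @` A, \pi_S @` B) => /=.
  by split; apply: jacobson_pi_nbhs.
by move=> [_ _] /= [[u Au <-] [v Bv <-]]; rewrite fg; exact: (AB (u, v)).
Qed.

Lemma jacobson_quot_sub_continuous : continuous (fun a : S * S => a.1 - a.2).
Proof.
apply: jacobson_quot_continuous2 (@sub_continuous R) => x y /=.
by rewrite jacobson_piD jacobson_piN.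
Qed.

HB.instance Definition _ := PreTopologicalNmodule_isTopologicalZmodule.Build S
  jacobson_quot_sub_continuous.

Lemma jacobson_quot_mul_continuous : continuous (fun a : S * S => a.1 * a.2).
Proof.
by apply: jacobson_quot_continuous2 mul_continuous => x y; rewrite jacobson_piM.
Qed.

HB.instance Definition _ := TopologicalZmodule_isTopologicalPzRing.Build S
  jacobson_quot_mul_continuous.

End TopologicalRings.

(* Main.v *)
Require Import Defs.
From mathcomp Require Import all_boot all_algebra.
From mathcomp Require Import generic_quotient.
From mathcomp Require Import finmap all_classical topology normedtype.
From mathcomp.analysis.showcase Require Import summability.

(** Write H for the topological Jacobson radical of R and S for R/H. In general
    H is larger than the Jacobson radical of R, so 1 - h may fail to be
    invertible for h in H, and idempotents of S cannot be lifted by the usual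
    power series. The proof goes through local idempotents e of R instead, whose
    corners H cannot disturb:
    - H contains no nonzero idempotent ([top_jacobson_idempotent]), so an
      element of e R e congruent to e modulo H is a unit of the local ring e R e
      ([corner_unit_lift]);
    - every element of e R outside H generates e R
      ([local_idempotent_top_jacobson]).

    Let f in R lift a primitive idempotent of S. As 1 is a sum of local
    idempotents and open maximal right ideals are closed, e f is not in H for
    some local e, hence e f s = e for some s. Modulo H, f s e f is then a
    nonzero idempotent of the corner of f, so it is f by primitivity
    ([primitive_idempotent_top_factor]). Thus, modulo H, f is the product q p of
    q = f s e and p = e f, while p q is e. The element p q of e R e has an
    inverse u there, and q u p is an exact idempotent, with local corner because
    it is equivalent to e ([local_idempotent_swap]), and congruent to f.

    Orthogonality is obtained one idempotent at a time: if E is the sum of the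
    lifts already built, the image of E annihilates that of f on both sides, so
    replacing p by p (1 - E) and q by (1 - E) q changes nothing modulo H and
    makes q u p orthogonal to E ([primitive_idempotent_lift]). *)

Set Implicit Arguments.
Unset Strict Implicit.
Unset Printing Implicit Defensive.

Import GRing.Theory.

Local Open Scope classical_set_scope.
Local Open Scope ring_scope.
Local Open Scope quotient_scope.

(** * Local idempotents *)

Section LocalIdempotents.
Context {R : pzRingType}.
Implicit Types e p q x y : R.

(** Invertibility in the corner ring, stated for elements of R so that corners
    of different idempotents can be compared without coercions. *)
Definition corner_unit e x : Prop :=
  exists y, [/\ e * y * e = y, x * y = e & y * x = e].

Lemma corner_unitP e (he : idempotent_elt e) (x : corner he) :
  invertible x <-> corner_unit e (val x).
Proof.
split=> [[y [xy yx]]|[y [hy xy yx]]].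
  exists (val y); split; first exact/eqP/(valP y).
  - by rewrite -[RHS]/(val (1 : corner he)) -xy.
  - by rewrite -[RHS]/(val (1 : corner he)) -yx.
have yP : corner_pred e y by apply/eqP.
by exists (Sub y yP); split; apply: val_inj.
Qed.

Lemma local_idempotentP e : local_idempotent e <->
  [/\ e * e = e, e != 0 &
      forall x y, e * x * e = x -> e * y * e = y ->
        ~ corner_unit e x -> ~ corner_unit e y -> ~ corner_unit e (x - y)].
Proof.
split=> [[he [e0 [_ hB]]]|[he e0 hB]].
  split=> // x y /eqP hx /eqP hy nx ny hxy.
  pose x' : corner he := exist _ x hx; pose y' : corner he := exist _ y hy.
  suff : ~ invertible (x' - y') by apply; apply/corner_unitP.
  by apply: hB => /= /corner_unitP.
exists he; split=> //; split=> [|x y /= nx ny].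
  move=> /corner_unitP[y [_ + _]]; rewrite mul0r => /esym /eqP.
  by rewrite (negbTE e0).
move=> /corner_unitP; apply: hB; [exact/eqP/(valP x)|exact/eqP/(valP y)| |].
- by move=> /corner_unitP.
- by move=> /corner_unitP.
Qed.

Lemma local_idempotent_unitB e x : local_idempotent e -> e * x * e = x ->
  ~ corner_unit e x -> corner_unit e (e - x).
Proof.
move=> /local_idempotentP[he _ hB] hx nx; apply: contrapT => nex.
have : ~ corner_unit e (e - x - - x).
  apply: hB => //; first by rewrite mulrBr mulrBl hx !he.
    by rewrite mulrN mulNr hx.
  move=> [y [ey xy yx]]; apply: nx; exists (- y).
  by rewrite mulrN mulNr ey mulrN -mulNr xy mulNr -mulrN yx.
by apply; rewrite opprK subrK; exists e; rewrite !he.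
Qed.

(** Equivalent idempotents p q and q p have isomorphic corners: x goes to
    p x q, with inverse y going to q y p. Locality is transported along it
    because it preserves differences and preserves and reflects units. *)
Lemma local_idempotent_swap e p q : local_idempotent e ->
  p * q = e -> e * p = p -> q * e = q -> local_idempotent (q * p).
Proof.
move=> /local_idempotentP[he e0 hB] pq ep qe.
have pE : p * (q * p) = p by rewrite mulrA pq.
have Eq : q * p * q = q by rewrite -mulrA pq.
have hE : q * p * (q * p) = q * p by rewrite -mulrA pE.
(* Multiplicativity of the isomorphism from the corner of q p to that of e. *)
have transportM x y : q * p * y = y ->
    p * x * q * (p * y * q) = p * (x * y) * q.
  by move=> Ey; rewrite -{2}Ey !mulrA.
have unit_swap x : q * p * x * (q * p) = x ->
    corner_unit (q * p) x <-> corner_unit e (p * x * q).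
  move=> hx; have Ex : q * p * x = x by rewrite -hx !mulrA Eq.
  have xE : x * (q * p) = x by rewrite -hx -!mulrA pE.
  split=> [[y [hy xy yx]]|[v [hv xv vx]]].
    have Ey : q * p * y = y by rewrite -hy !mulrA Eq.
    exists (p * y * q); split.
    - by rewrite !mulrA ep -!mulrA qe.
    - by rewrite transportM // xy pE pq.
    - by rewrite transportM // yx pE pq.
  exists (q * v * p); split.
  - by rewrite !mulrA Eq -!mulrA pE.
  - transitivity (q * (p * x * q * v) * p); last by rewrite xv qe.
    by rewrite -{1}Ex !mulrA.
  - transitivity (q * (v * (p * x * q)) * p); last by rewrite vx qe.
    by rewrite -{1}xE !mulrA.
apply/local_idempotentP; split=> //.
  apply: contra_neq e0 => E0.
  by rewrite -he -pq mulrA -(mulrA p q p) E0 mulr0 mul0r.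
have memC x : e * (p * x * q) * e = p * x * q by rewrite !mulrA ep -mulrA qe.
move=> x y hx hy; rewrite !unit_swap //; last by rewrite mulrBr mulrBl hx hy.
by rewrite mulrBr mulrBl; apply: hB.
Qed.
End LocalIdempotents.

(** * Open maximal right ideals and the topological Jacobson radical *)

Section TopologicalJacobson.
Context {R : topPzRingType}.
Implicit Types (I M : set R) (x y r e : R).

Lemma right_idealP I : right_ideal I ->
  [/\ I 0, forall x y, I x -> I y -> I (x - y),
      forall x y, I x -> I y -> I (x + y) & forall x r, I x -> I (x * r)].
Proof.
move=> [[I0 IB] IM]; split=> // x y Ix Iy.
by rewrite -[y]opprK; apply: (IB) => //; rewrite -sub0r; apply: IB.
Qed.

Lemma open_right_ideal_sup I M : open I -> right_ideal I -> right_ideal M ->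
  I `<=` M -> open M.
Proof.
move=> oI /right_idealP[I0 _ _ _] /right_idealP[_ _ MD _] IM.
rewrite openE => x Mx; rewrite /interior.
have c : continuous (fun y => y - x).
  move=> y; apply: (@continuous_comp _ _ _ (fun y => (y, x))
    (fun z : R * R => z.1 - z.2)); last exact: sub_continuous.
  by apply: cvg_pair => /=; [exact: cvg_id|exact: cvg_cst].
have : nbhs x [set y | I (y - x)].
  by apply: open_nbhs_nbhs; split; [exact: open_comp|rewrite /= subrr].
apply: filterS => y /= /IM My; rewrite -[y](subrK x); exact: MD.
Qed.

(** Zorn's lemma, applied to the sets whose union with I is a proper right
    ideal: unlike the proper right ideals above I, these include the union of
    the empty chain. *)
Lemma maximal_right_ideal_exists I : right_ideal I -> ~ I 1 ->
  exists2 M, maximal_right_ideal M & I `<=` M.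
Proof.
move=> hI nI1.
pose P M := right_ideal (I `|` M) /\ ~ (I `|` M) 1.
have /Zorn_bigcup[M [[hM nM1] maxM]] : forall F : set (set R), F `<=` P ->
    total_on F subset -> P (\bigcup_(M in F) M).
  move=> F FP tF; split; last first.
    by move=> [//|[M FM M1]]; have [_] := FP _ FM; apply; right.
  have [I0 IB _ IM] := right_idealP hI.
  split; last first.
    move=> x r [Ix|[M FM Mx]]; first by left; apply: IM.
    have [/right_idealP[_ _ _ /(_ x r)] + _] := FP _ FM.
    by case=> [|?|?]; [by right|left|right; exists M].
  split=> [|x y]; first by left.
  have inF M : F M -> (I `|` M) x -> (I `|` M) y ->
      (I `|` \bigcup_(M in F) M) (x - y).
    move=> FM hx hy; have [/right_idealP[_ /(_ x y hx hy) + _ _] _] := FP _ FM.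
    by case=> [?|?]; [left|right; exists M].
  move=> [Ix|[M FM Mx]] [Iy|[N FN Ny]].
  - by left; apply: IB.
  - by apply: (inF N) => //; [left|right].
  - by apply: (inF M) => //; [right|left].
  - have [MN|NM] := tF _ _ FM FN.
      by apply: (inF N) => //; right => //; apply: MN.
    by apply: (inF M) => //; right => //; apply: NM.
exists (I `|` M); last by move=> x Ix; left.
split=> //; first by apply/eqP => E; apply: nM1; rewrite E.
move=> J hJ IMJ; have [J1|nJ1] := pselect (J 1).
  right; apply/seteqP; split=> // x _; rewrite -[x]mul1r.
  by have [_ _ _] := right_idealP hJ; apply.
left; have EJ : I `|` J = J.
  by apply/seteqP; split=> x; [case=> // Ix; apply: IMJ; left|right].
apply: contrapT => nJ; apply: (maxM J); last by rewrite /P EJ.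
split=> [x Mx|JM]; first by apply: IMJ; right.
by apply: nJ; apply/seteqP; split=> // x /JM Mx; right.
Qed.

Lemma maximal_right_ideal_split M x : maximal_right_ideal M -> ~ M x ->
  exists r, M (1 - x * r).
Proof.
move=> [hM MT maxM] nMx; have [M0 MB MD MM] := right_idealP hM.
(* J is M + x R. *)
pose J := [set y | exists r, M (y - x * r)].
have hJ : right_ideal J.
  split=> [|y s [r Mr]].
    split=> [|y z [r Mr] [s Ms]]; first by exists 0; rewrite mulr0 subrr.
    exists (r - s).
    have -> : y - z - x * (r - s) = y - x * r - (z - x * s).
      by rewrite mulrBr !opprB addrACA [RHS]addrACA (addrC (- z)).
    exact: MB.
  by exists (r * s); rewrite mulrA -mulrBl; apply: MM.
have MJ : M `<=` J by move=> m Mm; exists 0; rewrite mulr0 subr0.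
have [JM|JT] := maxM J hJ MJ; last by have : J 1 by rewrite JT.
by case: nMx; rewrite -JM; exists 1; rewrite mulr1 subrr.
Qed.

Lemma top_jacobson_notP x : ~ top_jacobson x <->
  exists M, [/\ open M, maximal_right_ideal M & ~ M x].
Proof.
split=> [/existsNP[M /not_implyP[[oM hM] nMx]]|[M [oM hM nMx]]].
  by exists M.
by move=> /(_ M); apply: contra_not nMx; apply.
Qed.

(** If e is nonzero, separatedness provides an open right ideal I without e.
    The right ideal of the r with e r in I is open and proper and contains
    1 - e; an open maximal right ideal above it cannot contain e. *)
Lemma top_jacobson_idempotent e : complete_separated R ->
  e * e = e -> top_jacobson e -> e = 0.
Proof.
move=> hc he He.
(* The compatible family of trivial cosets I is represented by 0, and by e if
   e lies in every open right ideal; uniqueness then gives e = 0. *)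
have [c [_ c_uniq]] :
    exists! r : R, forall I, open_right_ideal I -> I = add_coset I r.
  apply: hc (fun I => I) _; split=> // I [_ [[I0 _] _]]; exists 0.
  by apply/seteqP; split=> x; rewrite /add_coset /= subr0.
have c0 : c = 0.
  by apply: c_uniq => I _; apply/seteqP; split=> x; rewrite /add_coset /= subr0.
rewrite -c0; apply/esym; apply: c_uniq => I [oI hI].
have [I0 IB ID IM] := right_idealP hI.
suff Ie : I e.
  apply/seteqP; split=> x Ix; first exact: IB.
  by rewrite -[x](subrK e); apply: ID.
apply: contrapT => nIe.
pose J := [set r | I (e * r)].
have hJ : right_ideal J.
  split=> [|x r /= Ix]; last by rewrite /J /= mulrA; apply: IM.
  split=> [|x y /= Ix Iy]; first by rewrite /J /= mulr0.
  by rewrite /J /= mulrBr; apply: IB.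
have oJ : open J by apply: open_comp oI => r _; apply: mulr_continuous.
have nJ1 : ~ J 1 by rewrite /J /= mulr1.
have [M hM JM] := maximal_right_ideal_exists hJ nJ1.
have [hM' MT _] := hM; have [_ _ MD MM] := right_idealP hM'.
have Me : M e by apply: He; split=> //; apply: open_right_ideal_sup JM.
have M1 : M 1.
  rewrite -[1](subrKC e); apply: MD => //; apply: JM.
  by rewrite /J /= mulrBr mulr1 he subrr.
by case/eqP: MT; apply/seteqP; split=> // x _; rewrite -[x]mul1r; apply: MM.
Qed.

(** Let M be an open maximal right ideal without x and 1 - x r in M. If x r e
    is a unit of e R e, then x divides e on the left. Otherwise
    e - x r e = (1 - x r) e is one by locality, so M contains e and x = e x,
    which is absurd. *)
Lemma local_idempotent_top_jacobson e x : local_idempotent e -> e * x = x ->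
  ~ top_jacobson x -> exists s, x * s = e.
Proof.
move=> he ex /top_jacobson_notP[M [oM hM nMx]].
have [he2 _ _] := (local_idempotentP e).1 he.
have [r Mr] := maximal_right_ideal_split hM nMx.
have [hM' _ _] := hM; have [_ _ _ MM] := right_idealP hM'.
have corner_xr : e * (x * r * e) * e = x * r * e.
  by rewrite !mulrA ex -!mulrA he2.
have [[v [_ xv _]]|nu] := pselect (corner_unit e (x * r * e)).
  by exists (r * e * v); rewrite !mulrA xv.
have [v [_ uv _]] := local_idempotent_unitB he corner_xr nu.
case: nMx; have -> : x = (1 - x * r) * (e * v * x).
  by rewrite -[LHS]ex -{1}uv !mulrA [(1 - _) * e]mulrBl mul1r.
exact: MM.
Qed.

(** An open right ideal M contains the difference between x and (sum of e_z) x
    for a large enough finite partial sum. Taking M maximal without x, some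
    e_z x must be outside M. *)
Lemma semiperfect_not_top_jacobson x : topologically_semiperfect R ->
  ~ top_jacobson x -> exists2 e, local_idempotent e & ~ top_jacobson (e * x).
Proof.
move=> [Z [e [_ _ e1 le]]] /top_jacobson_notP[M [oM hM nMx]].
have [hM' _ _] := hM; have [M0 MB MD _] := right_idealP hM'.
apply: contrapT => nex; apply: nMx.
have cx : continuous (fun y => y * x - x).
  move=> y; apply: (@continuous_comp _ _ _ (fun y => (y * x, x))
    (fun z : R * R => z.1 - z.2)); last exact: sub_continuous.
  apply: cvg_pair => /=; last exact: cvg_cst.
  apply: (@continuous_comp _ _ _ (fun y => (y, x))
    (fun z : R * R => z.1 * z.2)); last exact: Defs.mul_continuous.
  by apply: cvg_pair => /=; [exact: cvg_id|exact: cvg_cst].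
have : nbhs (1 : R) [set y | M (y * x - x)].
  apply: open_nbhs_nbhs; split; last by rewrite /= mul1r subrr.
  exact: open_comp.
move=> /e1[A _ /(_ A (fsubset_refl A)) /= MA].
have MAx : M (partial_sum e A * x).
  rewrite /partial_sum big_distrl /=; elim/big_ind: _ => // z _.
  apply: contrapT => nM; apply: nex; exists (e (val z)); first exact: le.
  by move=> /(_ M); apply: contra_not nM; apply.
by rewrite -[x](subKr (partial_sum e A * x)); apply: MB.
Qed.

End TopologicalJacobson.

(** * Lifting one primitive idempotent *)

Section LiftOne.
Context {R : topPzRingType}.
Context (R_complete : complete_separated R).
Local Notation pi := (\pi_(jacobson_quot R)).

Lemma jacobson_pi_eq0 (x : R) : pi x = 0 <-> top_jacobson x.
Proof.
have pi0 : pi 0 = 0.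
  by rewrite -[in LHS](subrr 0) jacobson_piD jacobson_piN subrr.
by rewrite -pi0 jacobson_quotP subr0.
Qed.

(** The radical replaces the nilpotent ideal of the classical lifting argument:
    e - x is a nonunit of e R e, for otherwise e would lie in H, hence x is a
    unit by locality. *)
Lemma corner_unit_lift e x : local_idempotent e -> e * x * e = x ->
  pi x = pi e -> exists u, [/\ e * u * e = u, x * u = e & pi u = pi e].
Proof.
move=> he ex pix; have [ee e0 _] := (local_idempotentP e).1 he.
have hex : top_jacobson (e - x) by apply/jacobson_quotP.
have [u [eu xu _]] : corner_unit e x.
  rewrite -[x](subKr e); apply: local_idempotent_unitB => //.
    by rewrite mulrBr mulrBl ex !ee.
  move=> [y [_ xy _]]; case/eqP: e0.
  apply: (top_jacobson_idempotent R_complete ee).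
  by rewrite -xy; apply: top_jacobsonMr.
exists u; split=> //; rewrite -xu jacobson_piM pix -jacobson_piM.
by rewrite -eu !mulrA ee.
Qed.

(** Since e f s = e, the element g = f s e f is idempotent modulo H, and it is
    nonzero modulo H because e g s = e. Its image lies in the corner of the
    image of f, so by primitivity the two images agree. *)
Lemma primitive_idempotent_top_factor (f : R) :
  topologically_semiperfect R -> primitive_idempotent (pi f) ->
  exists e s,
    [/\ local_idempotent e, e * f * s = e & pi (f * s * e * f) = pi f].
Proof.
move=> R_semiperfect [ff f0 f_prim].
have [e he nHef] : exists2 e, local_idempotent e & ~ top_jacobson (e * f).
  apply: semiperfect_not_top_jacobson => // /jacobson_pi_eq0 /eqP.
  by rewrite (negbTE f0).
have [ee e0 _] := (local_idempotentP e).1 he.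
have [s efs] : exists s, e * f * s = e.
  by apply: (local_idempotent_top_jacobson he) => //; rewrite mulrA ee.
exists e, s; split=> //.
set g := f * s * e * f.
have gg : pi g * pi g = pi g.
  rewrite /g -[in LHS]jacobson_piM.
  have -> : f * s * e * f * (f * s * e * f) = f * s * e * (f * f) * (s * e * f).
    by rewrite !mulrA.
  rewrite !jacobson_piM ff -!jacobson_piM.
  have -> // : f * s * e * f * (s * e * f) = f * s * (e * f * s) * e * f.
    by rewrite !mulrA.
  by rewrite efs -(mulrA _ e e) ee.
have fg : pi f * pi g = pi g by rewrite /g !jacobson_piM !mulrA ff.
have gf : pi g * pi f = pi g by rewrite /g !jacobson_piM -!mulrA ff.
have g0 : pi g != 0.
  apply: contra_neq e0 => /jacobson_pi_eq0 Hg.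
  apply: (top_jacobson_idempotent R_complete ee).
  have -> : e = e * g * s by rewrite -[LHS]ee -{1}efs -{2}efs /g !mulrA.
  by apply: top_jacobsonMr; apply: top_jacobsonMl.
apply: contrapT => ngf; apply: f_prim; exists (pi g), (pi f - pi g).
split=> //.
- by rewrite /idempotent_elt mulrBr !mulrBl ff gf fg gg subrr subr0.
- by rewrite subr_eq0; apply/eqP => /esym.
- by rewrite mulrBr mulrBl gf fg gg subrr addrC subrK.
Qed.

(** The factors 1 - E, invisible modulo H, make p and q annihilate E exactly;
    the inverse u of p q in the corner of e turns q p, idempotent only modulo H,
    into the idempotent q u p. *)
Lemma primitive_idempotent_lift (E : R) (f : jacobson_quot R) :
  topologically_semiperfect R -> E * E = E ->
  primitive_idempotent f -> pi E * f = 0 -> f * pi E = 0 ->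
  exists e, [/\ local_idempotent e, pi e = f, E * e = 0 & e * E = 0].
Proof.
move=> R_semiperfect; rewrite -[f]reprK; move: (repr f) => r EE r_prim Er rE.
have [rr _ _] := r_prim.
have [e [s [he ers pir]]] :=
  primitive_idempotent_top_factor R_semiperfect r_prim.
have [ee _ _] := (local_idempotentP e).1 he.
pose p := e * r * (1 - E); pose q := (1 - E) * r * s * e.
have ep : e * p = p by rewrite /p !mulrA ee.
have qe : q * e = q by rewrite /q -!mulrA ee.
have pip : pi p = pi (e * r).
  rewrite /p mulrBr mulr1 jacobson_piD jacobson_piN.
  rewrite -mulrA [pi (e * (r * E))]jacobson_piM (jacobson_piM r).
  by rewrite rE mulr0 subr0.
have piq : pi q = pi (r * s * e).
  rewrite /q -!mulrA mulrBl mul1r jacobson_piD jacobson_piN.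
  by rewrite [pi (E * _)]jacobson_piM (jacobson_piM r) mulrA Er mul0r subr0.
have pipq : pi (p * q) = pi e.
  rewrite jacobson_piM pip piq !jacobson_piM -!mulrA (mulrA (pi r) (pi r)) rr.
  by rewrite !mulrA -!jacobson_piM ers ee.
have epq : e * (p * q) * e = p * q by rewrite (mulrA e p) ep -(mulrA p) qe.
have [u [eu pqu piu]] := corner_unit_lift he epq pipq.
exists (q * u * p); split.
- apply: (local_idempotent_swap he) => //; first by rewrite mulrA.
  by rewrite -eu -!mulrA ee.
- rewrite (jacobson_piM _ p) (jacobson_piM q) piu pip piq -!jacobson_piM -pir.
  by rewrite !mulrA -(mulrA _ e e) ee -(mulrA _ e e) ee.
- suff Eq : E * q = 0 by rewrite -(mulrA q) (mulrA E q) Eq mul0r.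
  by rewrite /q !mulrA mulrBr mulr1 EE subrr !mul0r.
- suff pE : p * E = 0 by rewrite -(mulrA _ p) pE mulr0.
  by rewrite /p -!mulrA mulrBl mul1r EE subrr !mulr0.
Qed.
End LiftOne.

(** * Lifting finite orthogonal families *)

Theorem proposition10p1 (R : topPzRingType) (R_linear : right_linear R)
    (R_complete : complete_separated R)
    (R_semiperfect : topologically_semiperfect R)
    (n : nat) (f : 'I_n -> jacobson_quot R)
    (f_primitive : forall i : 'I_n, primitive_idempotent (f i))
    (f_orthogonal : orthogonal_family f) :
  exists e : 'I_n -> R,
    (forall i : 'I_n, local_idempotent (e i)) /\
    orthogonal_family e /\
    (forall i : 'I_n, \pi_(jacobson_quot R) (e i) = f i).
Proof.
(* Induction on the number k of indices already lifted, since each new lift has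
   to be made orthogonal to the sum of the previous ones. *)
have lift_below k : (k <= n)%N -> exists e : 'I_n -> R,
    [/\ forall i : 'I_n, (i < k)%N -> local_idempotent (e i),
        forall i : 'I_n, (i < k)%N -> \pi_(jacobson_quot R) (e i) = f i &
        forall i j : 'I_n, (i < k)%N -> (j < k)%N -> i <> j -> e i * e j = 0];
  last first.
  have [e [he pie oe]] := lift_below n (leqnn n).
  exists e; split=> [i|]; first exact: he.
  by split=> [i j|i]; [exact: oe|exact: pie].
elim: k => [_|k IH k_lt]; first by exists (fun=> 0).
have [e [he pie oe]] := IH (ltnW k_lt).
pose o := Ordinal k_lt; pose E := \sum_(i < n | (i < k)%N) e i.
have eE (i : 'I_n) : (i < k)%N -> e i * E = e i.
  move=> ik; rewrite /E (bigD1 i) //= mulrDr mulr_sumr big1 ?addr0.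
    by have /local_idempotentP[] := he i ik.
  by move=> j /andP[jk /eqP ji]; apply: oe => // /esym.
have EE : E * E = E by rewrite {1}/E mulr_suml; apply: eq_bigr => i; apply: eE.
have Ee (i : 'I_n) : (i < k)%N -> E * e i = e i.
  move=> ik; rewrite /E (bigD1 i) //= mulrDl mulr_suml big1 ?addr0.
    by have /local_idempotentP[] := he i ik.
  by move=> j /andP[jk /eqP ji]; apply: oe.
have piE : \pi_(jacobson_quot R) E = \sum_(i < n | (i < k)%N) f i.
  rewrite /E; elim/big_rec2: _ => [|i y x ik <-].
    by apply/jacobson_pi_eq0; have [] := top_jacobson_subgroup R.
  by rewrite jacobson_piD pie.
have [e' [he' pie' Ee' e'E]] : exists e', [/\ local_idempotent e',
    \pi_(jacobson_quot R) e' = f o, E * e' = 0 & e' * E = 0].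
  have neq_o (i : 'I_n) : (i < k)%N -> i <> o.
    by move=> + io; rewrite io /= ltnn.
  apply: primitive_idempotent_lift => //; rewrite piE.
    by rewrite mulr_suml big1 // => i /neq_o; apply: f_orthogonal.
  by rewrite mulr_sumr big1 // => i /neq_o/nesym; apply: f_orthogonal.
exists (fun i : 'I_n => if (i < k)%N then e i else e').
have ord_o (i : 'I_n) : (i < k.+1)%N -> (i < k)%N = false -> i = o.
  move=> ik /negbT nik; apply/val_inj/eqP.
  by rewrite /= eqn_leq -ltnS ik leqNgt.
split=> [i ik|i ik|i j ik jk ij].
- by case: ifP => // ?; apply: he.
- by case: ifP => [?|/ord_o ->//]; apply: pie.
case: ifP => ik'; case: ifP => jk'.
- exact: oe.
- by rewrite -(eE i) // -mulrA Ee' mulr0.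
- by rewrite -(Ee j) // mulrA e'E mul0r.
- by case: ij; rewrite (ord_o i) // (ord_o j).
Qed.
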